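(* Let $\theta>0$ and $\varepsilon\in(0,1)$. The distributionally robust chance constrained program $$\min_{\mathbf{x}\in\mathcal{X}}\ \mathbf{c}^\top\mathbf{x}\quad\text{s.t.}\quad\mathbb{P}[\tilde{\boldsymbol{\xi}}\in\mathcal{S}(\mathbf{x})]\ge1-\varepsilon\quad\forall\,\mathbb{P}\in\mathcal{F}(\theta)$$ is equivalent to the deterministic optimization problem $$\begin{array}{cll}\displaystyle\min_{\mathbf{s},t,\mathbf{x}}&\mathbf{c}^\top\mathbf{x}\\ \text{s.t.}&\varepsilon Nt-\mathbf{e}^\top\mathbf{s}\ge\theta N\\ &\mathbf{dist}(\hat{\boldsymbol{\xi}}_i,\bar{\mathcal{S}}(\mathbf{x}))\ge t-s_i&\forall i\in\{1,\dots,N\}\\ &\mathbf{s}\ge\mathbf{0},\ \mathbf{x}\in\mathcal{X},\end{array}$$ with variables $\mathbf{s}\in\mathbb{R}^N$, $t\in\mathbb{R}$, $\mathbf{x}\in\mathbb{R}^L$.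
   Context: Setting. $\|\cdot\|$ is an arbitrary norm on $\mathbb{R}^K$, and $\mathcal{P}(\mathbb{R}^K)$ is the set of all probability distributions on $\mathbb{R}^K$. For $\mathbb{P}_1,\mathbb{P}_2\in\mathcal{P}(\mathbb{R}^K)$ the (type-1) Wasserstein distance is $d_{\rm W}(\mathbb{P}_1,\mathbb{P}_2)=\inf_{\mathbb{P}\in\mathcal{P}(\mathbb{P}_1,\mathbb{P}_2)}\mathbb{E}_{\mathbb{P}}[\|\tilde{\boldsymbol{\xi}}_1-\tilde{\boldsymbol{\xi}}_2\|]$, where $\mathcal{P}(\mathbb{P}_1,\mathbb{P}_2)$ is the set of all distributions of $(\tilde{\boldsymbol{\xi}}_1,\tilde{\boldsymbol{\xi}}_2)$ on $\mathbb{R}^K\times\mathbb{R}^K$ with marginals $\mathbb{P}_1$ and $\mathbb{P}_2$. Given training samples $\hat{\boldsymbol{\xi}}_1,\dots,\hat{\boldsymbol{\xi}}_N\in\mathbb{R}^K$ ($N\ge1$), let $\hat{\mathbb{P}}=\frac1N\sum_{i=1}^N\delta_{\hat{\boldsymbol{\xi}}_i}$ be the empirical distribution, and define the Wasserstein ambiguity set $\mathcal{F}(\theta)=\{\mathbb{P}\in\mathcal{P}(\mathbb{R}^K)\mid d_{\rm W}(\mathbb{P},\hat{\mathbb{P}})\le\theta\}$. $\mathcal{X}\subseteq\mathbb{R}^L$ is a compact polyhedron and $\mathbf{c}\in\mathbb{R}^L$. For each $\mathbf{x}\in\mathcal{X}$, $\mathcal{S}(\mathbf{x})\subseteq\mathbb{R}^K$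 is an arbitrary open set (safety set) and $\bar{\mathcal{S}}(\mathbf{x})=\mathbb{R}^K\setminus\mathcal{S}(\mathbf{x})$ is its closed complement (unsafe set). For a closed set $\mathcal{C}\subseteq\mathbb{R}^K$, $\mathbf{dist}(\hat{\boldsymbol{\xi}},\mathcal{C})=\min\{\|\boldsymbol{\xi}-\hat{\boldsymbol{\xi}}\|\mid\boldsymbol{\xi}\in\mathcal{C}\}$, with the convention that this equals $+\infty$ if $\mathcal{C}=\emptyset$. $\mathbf{e}$ is the all-ones vector, $\mathbf{0}$ the zero vector, and vector inequalities are componentwise. ''Equivalent'' means: a decision $\mathbf{x}$ is feasible in the chance constrained program if and only if there exist $(\mathbf{s},t)$ such that $(\mathbf{s},t,\mathbf{x})$ is feasible in the deterministic problem (so that, the objectives being identical, optimal values and optimal decisions $\mathbf{x}$ coincide). *)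

(* Defs.v *)
From HB Require Import structures.
From mathcomp Require Import all_boot all_order all_algebra.
From mathcomp Require Import all_classical all_reals all_analysis.

Set Implicit Arguments.
Unset Strict Implicit.
Unset Printing Implicit Defensive.

Import Order.TTheory GRing.Theory Num.Theory.
Import numFieldNormedType.Exports.

Local Open Scope classical_set_scope.
Local Open Scope ring_scope.

(* Vectors are row vectors; the library's norm on ['rV[R]_K] is the sup norm.
   It is used only through the topology it induces, which is the topology of
   every norm on R^K. *)
Definition is_norm (R : realType) (K : nat) (nrm : 'rV[R]_K -> R) : Prop :=
  [/\ forall x, 0 <= nrm x,
      forall x, nrm x = 0 -> x = 0,
      forall (a : R) x, nrm (a *: x) = `|a| * nrm x
    & forall x y, nrm (x + y) <= nrm x + nrm y].

Notation borelRV R K := (g_sigma_algebraType (@open 'rV[R]_K)).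

(* The Borel sigma-algebra of R^K x R^K is the product sigma-algebra, since
   R^K is second countable. *)
Definition coupling (R : realType) (K : nat)
    (P1 P2 : probability (borelRV R K) R) :
    set (probability (borelRV R K * borelRV R K)%type R) :=
  [set Q | forall A : set (borelRV R K), measurable A ->
     pushforward Q fst A = P1 A /\ pushforward Q snd A = P2 A].

Definition wasserstein (R : realType) (K : nat) (nrm : 'rV[R]_K -> R)
    (P1 P2 : probability (borelRV R K) R) : \bar R :=
  ereal_inf [set expectation Q (fun z : 'rV[R]_K * 'rV[R]_K => nrm (z.1 - z.2))
            | Q in coupling P1 P2].

(* The unused argument [0 < N] is what makes [empirical] a probability. *)
Definition empirical (R : realType) (K N : nat) (N_gt0 : (0 < N)%N)
    (xi : 'I_N -> borelRV R K) (A : set (borelRV R K)) : \bar R :=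
  ((N%:R^-1)%:E * \sum_(i < N) \d_(xi i) A)%E.

Section empirical_probability.
Variables (R : realType) (K N : nat) (N_gt0 : (0 < N)%N).
Variable xi : 'I_N -> borelRV R K.

Let invN_ge0 : 0 <= N%:R^-1 :> R. Proof. by rewrite invr_ge0. Qed.

Let xi' (k : nat) : borelRV R K := xi (insubd (Ordinal N_gt0) k).

Let empE : empirical N_gt0 xi =
  mscale (NngNum invN_ge0) (msum (fun k => \d_(xi' k)) N).
Proof.
apply/funext => A; rewrite /empirical /mscale /msum /=; congr (_ * _)%E.
by apply: eq_bigr => i _; rewrite /xi' valKd.
Qed.

Let emp0 : empirical N_gt0 xi set0 = 0%E.
Proof. by rewrite empE measure0. Qed.

Let emp_ge0 A : (0 <= empirical N_gt0 xi A)%E.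
Proof. by rewrite empE. Qed.

Let emp_sigma_additive : semi_sigma_additive (empirical N_gt0 xi).
Proof. rewrite empE; exact: measure_semi_sigma_additive. Qed.

HB.instance Definition _ := isMeasure.Build _ _ _ (empirical N_gt0 xi)
  emp0 emp_ge0 emp_sigma_additive.

Let emp_setT : empirical N_gt0 xi setT = 1%E.
Proof.
rewrite /empirical (eq_bigr (fun _ => 1%E)) => [|i _]; last exact: diracT.
rewrite sumEFin sumr_const card_ord -EFinM mulVf //.
by rewrite pnatr_eq0 -lt0n.
Qed.

HB.instance Definition _ := Measure_isProbability.Build _ _ _
  (empirical N_gt0 xi) emp_setT.

End empirical_probability.

Definition ambiguity_set (R : realType) (K N : nat) (nrm : 'rV[R]_K -> R)
    (N_gt0 : (0 < N)%N) (xi : 'I_N -> 'rV[R]_K) (theta : R) :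
    set (probability (borelRV R K) R) :=
  [set P | (wasserstein nrm P (empirical N_gt0 xi) <= theta%:E)%E].

(* For closed nonempty [C] the infimum is attained; for [C = set0] it is
   [+oo]. *)
Definition dist (R : realType) (K : nat) (nrm : 'rV[R]_K -> R)
    (x : 'rV[R]_K) (C : set 'rV[R]_K) : \bar R :=
  ereal_inf [set (nrm (y - x))%:E | y in C].

Definition polyhedron (R : realType) (L : nat) (X : set 'rV[R]_L) : Prop :=
  exists (m : nat) (A : 'M[R]_(m, L)) (b : 'cV[R]_m),
    X = [set x | forall i, (A *m x^T) i ord0 <= b i ord0].

Definition dotv (R : realType) (L : nat) (c x : 'rV[R]_L) : R :=
  \sum_(j < L) c ord0 j * x ord0 j.

Definition drccp_feasible (R : realType) (K L N : nat) (nrm : 'rV[R]_K -> R)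
    (N_gt0 : (0 < N)%N) (xi : 'I_N -> 'rV[R]_K) (X : set 'rV[R]_L)
    (S : 'rV[R]_L -> set 'rV[R]_K) (theta eps : R) : set 'rV[R]_L :=
  [set x | X x /\
     forall P : probability (borelRV R K) R,
       ambiguity_set nrm N_gt0 xi theta P -> ((1 - eps)%:E <= P (S x))%E].

(* Decisions are triples (s, t, x). *)
Definition det_feasible (R : realType) (K L N : nat) (nrm : 'rV[R]_K -> R)
    (xi : 'I_N -> 'rV[R]_K) (X : set 'rV[R]_L)
    (S : 'rV[R]_L -> set 'rV[R]_K) (theta eps : R) :
    set ('rV[R]_N * R * 'rV[R]_L) :=
  [set z : 'rV[R]_N * R * 'rV[R]_L | let: (s, t, x) := z in
     [/\ eps * N%:R * t - \sum_(i < N) s ord0 i >= theta * N%:R,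
         forall i, ((t - s ord0 i)%:E <= dist nrm (xi i) (~` S x))%E,
         forall i, 0 <= s ord0 i
       & X x]].

(* Minimization of [f] over [F]. *)
Definition opt_value (R : realType) (T : Type) (f : T -> R) (F : set T) :
    \bar R :=
  ereal_inf [set (f z)%:E | z in F].

Definition is_optimal (R : realType) (T : Type) (f : T -> R) (F : set T)
    (z : T) : Prop :=
  F z /\ forall z', F z' -> f z <= f z'.

(* Main.v *)
Require Import Defs.
From HB Require Import structures.
From mathcomp Require Import all_boot all_order all_algebra.
From mathcomp Require Import all_classical all_reals all_analysis.
From mathcomp Require Import ring lra.
From mathcomp Require Import measurable_realfun.

Set Implicit Arguments.
Unset Strict Implicit.
Unset Printing Implicit Defensive.

Import Order.TTheory GRing.Theory Num.Theory.
Import numFieldNormedType.Exports.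

Local Open Scope classical_set_scope.
Local Open Scope ring_scope.

(** Fix a decision x and write C for its unsafe set, d_i for the distance from
    the sample xi_i to C.  The chance constraint says that no distribution in
    the Wasserstein ball puts more than eps of its mass on C.  Both directions
    are the two halves of linear programming duality for the cheapest way of
    transporting mass eps from the samples into C.

    Weak duality ([coupling_tail_bound]).  Suppose (s, t) is feasible with x.
    A coupling of P and the empirical distribution pays at least t - s_i for
    each unit of mass that it moves from xi_i into C, so its cost is at least
    t P(C) minus the mean of s.  Taking the infimum over couplings,
    t P(C) <= theta + (sum of s) / N <= eps t, and t is positive by the budget
    constraint.

    Strong duality ([fractional_knapsack]).  To bring mass eps into C as
    cheaply as possible, move the samples with smallest d_i completely and one
    last distance level partially.  With t that last level, the weights w of
    this greedy plan satisfy
    sum_i w_i d_i = eps N t - sum_i max(0, t - d_i).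
    If s_i = max(0, t - d_i) violates the budget constraint, the plan costs
    strictly less than theta N.  The slack pays for moving a little more mass
    than eps, to points of C that are only nearly closest, and the resulting
    distribution ([exists_partial_move]) lies in the ball and violates the
    chance constraint.

    Both arguments only use that the integral of a nonnegative function is the
    supremum of the integrals of the simple functions below it.  Read this way,
    monotonicity and an upper bound for integrals against finitely many atoms
    hold for every nonnegative integrand, and they apply to the transport cost
    directly, without a proof that it is measurable for the product
    sigma-algebra.
*)

(** * Lower integrals and finitely supported probabilities *)

Section lower_integral.
Context d (T : measurableType d) (R : realType).
Local Open Scope ereal_scope.

(** The simple functions below [f] are among those below [g]. *)
Lemma le_integral_lower (mu : {measure set T -> \bar R}) (f g : T -> \bar R) :
  (forall x, 0 <= f x) -> (forall x, f x <= g x) ->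
  \int[mu]_x f x <= \int[mu]_x g x.
Proof.
move=> f0 fg; have g0 x : 0 <= g x by exact: le_trans (fg x).
rewrite !ge0_integralTE//; apply: le_ereal_sup => _ [h /= hf <-].
by exists h => // x; exact: le_trans (fg x).
Qed.

Section atomic.
Variables (J : finType) (p : J -> R) (p_ge0 : forall j, (0 <= p j)%R).
Variable a : J -> T.

Import HBNNSimple.

(* [msum] takes a sequence of measures, so [J] is reached through its
   enumeration. *)
Let atom (k : nat) : {measure set T -> \bar R} :=
  if insub k is Some i
  then mscale (NngNum (p_ge0 (enum_val i))) \d_(a (@enum_val J predT i))
  else mzero.

Definition atomic : set T -> \bar R := msum atom #|J|.

HB.instance Definition _ := Measure.on atomic.

Lemma atomicE A : atomic A = \sum_j (p j)%:E * \d_(a j) A.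
Proof.
rewrite /atomic /msum [RHS](reindex _ (onW_bij _ (@enum_val_bij J)))/=.
by apply: eq_bigr => i _; rewrite /atom valK.
Qed.

Lemma atomic_setT : (\sum_j p j = 1)%R -> atomic setT = 1.
Proof.
move=> p1; rewrite atomicE -[RHS]/(1%:E) -p1 -sumEFin.
by apply: eq_bigr => j _; rewrite diracT mule1.
Qed.

(** Every simple function below [f] has the integral [\sum_j p j * h (a j)],
    which is at most the right-hand side.  Equality can fail when [f] is not
    measurable. *)
Lemma integral_atomic_le (f : T -> R) : (forall x, 0 <= f x)%R ->
  \int[atomic]_x (f x)%:E <= (\sum_j p j * f (a j))%:E.
Proof.
move=> f0; rewrite ge0_integralTE//=.
apply: ge_ereal_sup => _ [h /= hf <-].
have mh : measurable_fun [set: T] (fun x => (h x)%:E).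
  exact/measurable_EFinP/measurable_funTS.
have h0 x : 0 <= (h x)%:E by rewrite lee_fin; exact: fun_ge0.
have -> : sintegral atomic h = (\sum_j p j * h (a j))%:E.
  transitivity (\int[msum atom #|J|]_x (h x)%:E).
    by rewrite integral_nnsfun// patch_setT.
  rewrite ge0_integral_measure_sum//.
  rewrite -sumEFin [RHS](reindex _ (onW_bij _ (@enum_val_bij J)))/=.
  apply: eq_bigr => i _; rewrite /atom valK ge0_integral_mscale//=.
  by rewrite integral_dirac// diracT mul1e.
by rewrite lee_fin; apply: ler_sum => j _; rewrite ler_wpM2l// -lee_fin.
Qed.

End atomic.

Definition atomic_probability (J : finType) (p : J -> R)
    (p_ge0 : forall j, (0 <= p j)%R) (p1 : (\sum_j p j = 1)%R) (a : J -> T) :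
    probability T R :=
  HB.pack (atomic p_ge0 a)
    (Measure_isProbability.Build _ _ _ (atomic p_ge0 a) (atomic_setT p_ge0 a p1)).

End lower_integral.

(** * The greedy fractional knapsack *)

(** Strong duality for the fractional knapsack problem: the weights fill the
    capacity [e] in increasing order of the costs [d], and [t] is the cost level
    at which the capacity runs out.  Complementary slackness, [w i = 1] below
    [t] and [w i = 0] above it, makes
    [w i * d i = w i * t - max 0 (t - d i)] hold for each [i] separately. *)
Lemma fractional_knapsack (R : realFieldType) (N : nat) (d : 'I_N -> R) (e : R) :
  0 <= e < N%:R ->
  exists t (w : 'I_N -> R), [/\ forall i, 0 <= w i <= 1, \sum_i w i = e
    & \sum_i w i * d i = e * t - \sum_i Num.max 0 (t - d i)].
Proof.
move=> /andP[e_ge0 e_ltN].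
pose below t := \sum_i (d i < t)%R%:R : R.
pose at_ t := \sum_i (d i == t)%R%:R : R.
have below_at i : \sum_j (d j <= d i)%R%:R = below (d i) + at_ (d i).
  rewrite -big_split; apply: eq_bigr => j _ /=.
  by case: (ltgtP (d j) (d i)); rewrite ?addr0 ?add0r.
have [k /andP[below_le ge_at]] : exists k, below (d k) <= e < below (d k) + at_ (d k).
  (* [d k] is the least cost whose lower level set has more than [e] elements. *)
  have N_gt0 : (0 < N)%N by rewrite -(ltr_nat R); exact: le_lt_trans e_ltN.
  pose Pk i := e < \sum_j (d j <= d i)%R%:R.
  have [m _ max_m] := @arg_maxP _ _ _ (Ordinal N_gt0) xpredT d isT.
  have le_m j : d j <= d m by exact: max_m.
  have Pm : Pk m.
    rewrite /Pk (eq_bigr (fun=> 1)) => [|j _]; last by rewrite le_m.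
    by rewrite sumr_const card_ord.
  have [k Pk_k min_k] := @arg_minP _ _ _ m Pk d Pm.
  exists k; rewrite -below_at -/(Pk k) Pk_k andbT leNgt; apply/negP => e_lt.
  have [j0 j0P] : exists j0, d j0 < d k.
    apply/existsP; apply: contraT => /existsPn none.
    move: e_lt; rewrite ltNge /below big1 ?e_ge0// => i _.
    by rewrite (negbTE (none i)).
  (* If [e] were below the number of costs under [d k], the largest of these
     costs would contradict the minimality of [d k]. *)
  have [l l_lt max_l] := @arg_maxP _ _ _ j0 (fun j => d j < d k) d j0P.
  have : Pk l.
    rewrite /Pk; apply: (lt_le_trans e_lt); apply: ler_sum => j _; rewrite ler_nat.
    by case: (boolP (d j < d k)) => //= j_lt;
      rewrite (max_l j j_lt : d j <= d l).
  by move=> /min_k /=; rewrite leNgt l_lt.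
pose t := d k; pose p := (e - below t) / at_ t.
have at_gt0 : 0 < at_ t by lra.
have p01 : 0 <= p <= 1.
  by rewrite /p divr_ge0 ?ler_pdivrMr ?(ltW at_gt0)//=; lra.
exists t, (fun i => (d i < t)%R%:R + p * (d i == t)%R%:R); split.
- by move=> i; case: (ltgtP (d i) t) => _ /=; lra.
- rewrite big_split -mulr_sumr /= -/(below t) -/(at_ t) /p.
  by rewrite divfK ?gt_eqF// addrC subrK.
- rewrite -[in e * t](_ : below t + p * at_ t = e); last first.
    by rewrite /p divfK ?gt_eqF// addrC subrK.
  rewrite /below /at_ mulr_sumr -big_split mulr_suml -sumrB /=.
  apply: eq_bigr => i _; case: (ltgtP (d i) t) => [lt_it|lt_ti|->] /=.
  + by rewrite max_r; lra.
  + by rewrite max_l; lra.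
  + by rewrite subrr maxxx; lra.
Qed.

(** * Transport to and from the empirical distribution *)

Section transport.
Context (R : realType) (K N : nat) (nrm : 'rV[R]_K -> R).
Hypothesis nrmP : is_norm nrm.
Variables (N_gt0 : (0 < N)%N) (xi : 'I_N -> borelRV R K).

Let nrm_ge0 x : 0 <= nrm x. Proof. by case: nrmP. Qed.

Let invN_ge0 : 0 <= N%:R^-1 :> R. Proof. by rewrite invr_ge0. Qed.

Lemma empirical_atomic (A : set (borelRV R K)) :
  empirical N_gt0 xi A = atomic (fun=> invN_ge0) xi A.
Proof.
by rewrite atomicE /empirical ge0_sume_distrr// => i _; exact: measure_ge0.
Qed.

Lemma measurable_point (y : 'rV[R]_K) : measurable ([set y] : set (borelRV R K)).
Proof.
rewrite -[X in measurable X]setCK; apply: measurableC.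
apply: sub_sigma_algebra; apply: closed_openC.
exact/accessible_closed_set1/hausdorff_accessible/norm_hausdorff.
Qed.

(** Weak duality.  The pair [(t \1_C, s')], with [s'] equal to [s i] at the
    sample [xi i] and to [t] away from the samples, is a feasible dual potential:
    [t \1_C(y) - s'(z) <= nrm (y - z)]. Integrating it against the coupling
    gives the bound. *)
Lemma coupling_tail_bound (C : set (borelRV R K)) (mC : measurable C)
    (P : probability (borelRV R K) R)
    (Q : probability (borelRV R K * borelRV R K)%type R)
    (QP : coupling P (empirical N_gt0 xi) Q) (t : R) (s : 'I_N -> R) :
  0 <= t -> (forall i, 0 <= s i) ->
  (forall i y, C y -> t - s i <= nrm (y - xi i)) ->
  (t%:E * P C <=
   expectation Q (fun z : 'rV[R]_K * 'rV[R]_K => nrm (z.1 - z.2)) +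
   (N%:R^-1 * \sum_i s i)%:E)%E.
Proof.
move=> t_ge0 s_ge0 sC.
(* The minimum resolves coinciding samples in favour of the least [s i], and
   caps [s'] by [t]. *)
pose s' (y : borelRV R K) : R :=
  \big[Num.min/t]_(i < N) (t + (s i - t) * \1_[set xi i] y).
have ind_at i : \1_[set xi i] (xi i) = 1 :> R by rewrite indicE mem_set.
have s'_ge0 y : 0 <= s' y.
  rewrite /s'; elim/big_ind: _ => // [u v u0 v0|i _]; first by rewrite le_min u0.
  by rewrite indicE; case: (_ \in _); rewrite ?mulr1 ?mulr0 ?addr0// addrC subrK.
have s'_le i : s' (xi i) <= s i.
  rewrite /s' (bigD1 i)//= ge_min; apply/orP; left.
  by rewrite ind_at mulr1 addrC subrK.
have ms' : measurable_fun [set: borelRV R K] s'.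
  rewrite /s'; elim: (index_enum _) => [|i r IH].
    by under eq_fun do rewrite big_nil; exact: measurable_cst.
  under eq_fun do rewrite big_cons.
  apply: measurable_minr => //; apply: measurable_funD => //.
  by apply: measurable_funM => //; apply: measurable_indic; exact: measurable_point.
have s'_gap y z : C y -> t - s' z <= nrm (y - z).
  move=> Cy; rewrite lerBlDr -lerBlDl /s'.
  elim/big_ind: _ => [|u v u0 v0|i _].
  - by rewrite lerBlDr lerDl.
  - by rewrite le_min u0.
  - rewrite indicE; case: (boolP (z \in _)) => [|_].
      rewrite inE => ->; rewrite mulr1 [t + _]addrC subrK.
      by rewrite lerBlDl -lerBlDr sC.
    by rewrite mulr0 addr0 lerBlDr lerDl.
pose D : set (borelRV R K * borelRV R K) := fst @^-1` C.
have mD : measurable D by rewrite /D -[_ @^-1` _]setTI; exact: measurable_fst.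
pose F z : R := t * \1_D z.
pose G (z : borelRV R K * borelRV R K) : R := s' z.2.
(* The positive part is a measurable minorant of the cost. *)
pose H z : R := Num.max 0 (F z - G z).
have mF : measurable_fun setT F.
  by apply: measurable_funM => //; exact: measurable_indic.
have mG : measurable_fun setT G by exact: measurableT_comp.
have mH : measurable_fun setT H.
  by apply: measurable_maxr => //; exact: measurable_funB.
have F_ge0 z : 0 <= F z by rewrite mulr_ge0.
have intF : (\int[Q]_z (F z)%:E = t%:E * P C)%E.
  under eq_integral do rewrite EFinM.
  rewrite ge0_integralZl//; last exact/measurable_EFinP/measurable_indic.
  by rewrite integral_indic// setIT -(QP C mC).1.
have intG : (\int[Q]_z (G z)%:E <= (N%:R^-1 * \sum_i s i)%:E)%E.
  rewrite -(@ge0_integral_pushforward _ _ _ _ _ _ measurable_snd Q setT (EFin \o s'))//; last 2 first.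
  - exact/measurable_EFinP.
  - by move=> y _; rewrite /= lee_fin.
  rewrite (eq_measure_integral (atomic (fun=> invN_ge0) xi)); last first.
    move=> A mA _; transitivity (empirical N_gt0 xi A).
      exact: (QP A mA).2.
    exact: empirical_atomic.
  apply: (le_trans (integral_atomic_le _ _ _)) => //.
  rewrite lee_fin mulr_sumr; apply: ler_sum => i _.
  exact: ler_wpM2l.
have H_le z : H z <= nrm (z.1 - z.2).
  rewrite /H ge_max nrm_ge0 /= /F /G indicE.
  case: (boolP (z \in D)) => [|_]; first by rewrite inE mulr1 => /s'_gap.
  by rewrite mulr0 sub0r (le_trans _ (nrm_ge0 _))// oppr_le0.
rewrite -intF unlock; apply: (@le_trans _ _ (\int[Q]_z (H z + G z)%:E)%E).
  apply: (@le_integral_lower _ _ _ Q) => z; rewrite lee_fin//.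
  by rewrite -lerBlDr /H le_max lexx orbT.
under eq_integral do rewrite EFinD.
rewrite ge0_integralD//; last 4 first.
- by move=> z _; rewrite lee_fin le_max lexx.
- exact/measurable_EFinP.
- by move=> z _; rewrite lee_fin; exact: s'_ge0.
- exact/measurable_EFinP.
apply: leeD => //; apply: (@le_integral_lower _ _ _ Q) => z; rewrite lee_fin//.
by rewrite le_max lexx.
Qed.

(** Each sample [xi i] splits its mass 1/N: the fraction [w i] goes to [y i], the
    rest stays.  The coupling is the joint law of the new and the old position,
    so only the moved mass is charged. *)
Lemma exists_partial_move (w : 'I_N -> R) (y : 'I_N -> borelRV R K) :
  (forall i, 0 <= w i <= 1) ->
  exists P : probability (borelRV R K) R,
    (wasserstein nrm P (empirical N_gt0 xi) <=
      (N%:R^-1 * \sum_i w i * nrm (y i - xi i))%:E)%E /\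
    forall A : set (borelRV R K), (forall i, ~ A (y i)) ->
      (P A <= (1 - N%:R^-1 * \sum_i w i)%:E)%E.
Proof.
move=> w01; have w0 i : 0 <= w i by case/andP: (w01 i).
have w1 i : 0 <= 1 - w i by rewrite subr_ge0; case/andP: (w01 i).
(* An atom is a sample together with a flag telling moved from unmoved mass. *)
pose p (j : 'I_N * bool) : R := N%:R^-1 * (if j.2 then w j.1 else 1 - w j.1).
pose a (j : 'I_N * bool) : borelRV R K := if j.2 then y j.1 else xi j.1.
have sum_pair (V : nmodType) (f : 'I_N * bool -> V) :
    \sum_j f j = \sum_i (f (i, true) + f (i, false)).
  rewrite (eq_bigr (fun j => f (j.1, j.2))) => [|[]//].
  rewrite -(pair_bigA _ (fun i b => f (i, b))) /=.
  by apply: eq_bigr => i _; rewrite big_bool.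
have p_ge0 j : 0 <= p j by rewrite mulr_ge0//; case: ifP.
have p1 : \sum_j p j = 1.
  rewrite sum_pair /p /= (eq_bigr (fun=> N%:R^-1)) => [|i _].
    by rewrite sumr_const card_ord -[_ *+ _]mulr_natr mulVf// pnatr_eq0 -lt0n.
  by rewrite -mulrDr addrC subrK mulr1.
pose P := atomic_probability p_ge0 p1 a.
pose Q := atomic_probability p_ge0 p1 (fun j => (a j, xi j.1)).
have nrm0 : nrm 0 = 0.
  by case: nrmP => _ _ nrmZ _; rewrite -(scale0r 0) nrmZ normr0 mul0r.
exists P; split; last first.
  move=> A Ay; rewrite [P A](atomicE p_ge0 a A) sum_pair mulr_sumr.
  have -> : 1 - \sum_i N%:R^-1 * w i = \sum_i p (i, false).
    apply/eqP; rewrite subr_eq -big_split /=; apply/eqP.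
    rewrite -[LHS]p1 sum_pair; apply: eq_bigr => i _; exact: addrC.
  rewrite -sumEFin; apply: lee_sum => i _.
  rewrite {1}/a /= !diracE memNset// mule0 add0e.
  by rewrite -EFinM lee_fin ler_piMr// lern1 leq_b1.
have QP : coupling P (empirical N_gt0 xi) Q.
  move=> A mA; split.
    by rewrite [RHS](atomicE p_ge0 a A) /pushforward [LHS]atomicE.
  transitivity (atomic (fun=> invN_ge0) xi A); last exact/esym/empirical_atomic.
  rewrite [RHS]atomicE /pushforward [LHS]atomicE sum_pair.
  apply: eq_bigr => i _; rewrite -ge0_muleDl ?lee_fin//.
  by rewrite -EFinD /p /= -mulrDr addrC subrK mulr1.
apply: le_trans (ereal_inf_lbound _) _; first by exists Q.
rewrite unlock; apply: le_trans (integral_atomic_le _ _ _) _ => //.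
rewrite lee_fin sum_pair mulr_sumr; apply: ler_sum => i _.
by rewrite /p /a /= subrr nrm0 mulr0 addr0 mulrA.
Qed.

End transport.

(** * The two feasibility problems *)

Section feasibility.
Context (R : realType) (K L N : nat) (nrm : 'rV[R]_K -> R).
Hypothesis nrmP : is_norm nrm.
Variables (N_gt0 : (0 < N)%N) (xi : 'I_N -> 'rV[R]_K).
Variables (X : set 'rV[R]_L) (S : 'rV[R]_L -> set 'rV[R]_K).
Hypothesis S_open : forall x, X x -> open (S x).
Variables (theta eps : R).
Hypotheses (theta_gt0 : 0 < theta) (eps_gt0 : 0 < eps) (eps_lt1 : eps < 1).

Let N_gt0' : 0 < N%:R :> R. Proof. by rewrite ltr0n. Qed.

Let chance := drccp_feasible nrm N_gt0 xi X S theta eps.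
Let determ := det_feasible nrm xi X S theta eps.

(** The tail bound holds for every coupling, so it passes to the infimum that
    defines the Wasserstein distance. *)
Lemma determ_chance s t x : determ (s, t, x) -> chance x.
Proof.
move=> [budget sC s_ge0 Xx]; split => // P PF.
have mS : measurable (S x : set (borelRV R K)).
  by apply: sub_sigma_algebra; exact: S_open.
have t_gt0 : 0 < t.
  have: 0 < eps * N%:R * t.
    have : 0 <= \sum_i s ord0 i by exact: sumr_ge0.
    have := mulr_gt0 theta_gt0 N_gt0'; lra.
  by rewrite pmulr_rgt0// mulr_gt0.
pose C : set (borelRV R K) := ~` S x.
have mC : measurable C by exact: measurableC.
have PCfin : P C \is a fin_num by exact: fin_num_measure.
have lower : ((t * fine (P C) - N%:R^-1 * \sum_i s ord0 i)%:E <=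
    wasserstein nrm P (empirical N_gt0 xi))%E.
  apply: (@le_ereal_inf_tmp R) => _ [Q QP <-].
  rewrite EFinB EFinM fineK// leeBlDr//.
  apply: (coupling_tail_bound nrmP mC QP (ltW t_gt0)) => // i y Cy.
  by rewrite -lee_fin (le_trans (sC i))//; apply: ereal_inf_lbound; exists y.
have {lower} : t * fine (P C) - N%:R^-1 * \sum_i s ord0 i <= theta.
  by rewrite -lee_fin; exact: le_trans lower PF.
rewrite mulrC lerBlDr => tail.
have PC_le : fine (P C) <= eps.
  rewrite -(ler_pM2r t_gt0); apply: (le_trans tail).
  rewrite -(ler_pM2r N_gt0') mulrDl mulrAC mulVf ?gt_eqF// mul1r; lra.
have -> : S x = ~` C by rewrite setCK.
by rewrite probability_setC// -(fineK PCfin) -EFinB lee_fin; lra.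
Qed.

(** The greedy weights [w] yield the candidate [(s, t)].  If it misses the budget
    constraint, the greedy plan costs less than [theta * N]; half of the gap
    pays for the extra mass, the other half for the nearly closest targets. *)
Lemma chance_determ x : chance x -> exists s t, determ (s, t, x).
Proof.
move=> [Xx chance_x].
have [C0|/set0P[y0 Cy0]] := eqVneq (~` S x) set0.
  (* No unsafe point: the distances are infinite, and any [t] with
     [eps * t >= theta] will do. *)
  exists 0, (theta / eps); split => //.
  - rewrite big1 ?subr0; last by move=> i _; rewrite mxE.
    by rewrite mulrAC (mulrC eps) divfK ?gt_eqF.
  - by move=> i; rewrite C0 /dist image_set0 ereal_inf0 leey.
  - by move=> i; rewrite mxE.
have distE i : dist nrm (xi i) (~` S x) \is a fin_num.
  have [nrm_ge0 _ _ _] := nrmP.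
  rewrite ge0_fin_numE; last first.
    by apply: le_ereal_inf_tmp => _ [y _ <-]; rewrite lee_fin.
  apply: (@le_lt_trans _ _ (nrm (y0 - xi i))%:E); last exact: ltry.
  by apply: ereal_inf_lbound; exists y0.
pose d i := fine (dist nrm (xi i) (~` S x)).
have d_ge0 i : 0 <= d i.
  apply: fine_ge0; apply: le_ereal_inf_tmp => _ [y _ <-].
  by rewrite lee_fin; case: nrmP.
have [|t [w [w01 w_sum w_cost]]] := fractional_knapsack d (e := eps * N%:R).
  by rewrite mulr_ge0 ?ltW//= gtr_pMl.
exists (\row_i Num.max 0 (t - d i)), t.
have s_sum : \sum_i (\row_i Num.max 0 (t - d i)) ord0 i =
    \sum_i Num.max 0 (t - d i) by apply: eq_bigr => i _; rewrite mxE.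
split => //; last 2 first.
- move=> i; rewrite -[leRHS]fineK// lee_fin -/(d i) mxE.
  by rewrite lerBlDr -lerBlDl le_max lexx orbT.
- by move=> i; rewrite mxE le_max lexx.
rewrite s_sum -w_cost leNgt; apply/negP => cost_lt.
pose gap := theta * N%:R - \sum_i w i * d i.
pose D := \sum_i d i.
have gap_gt0 : 0 < gap by rewrite subr_gt0.
have D_ge0 : 0 <= D by exact: sumr_ge0.
(* Giving the all-ones weights the proportion [lam] in a mixture with [w] adds
   at most [lam * D <= gap / 2] to the cost, and it raises the total weight
   above [eps * N] because [eps < 1]. *)
pose lam := gap / (2 * (D + gap)).
have lam_gt0 : 0 < lam by rewrite divr_gt0// mulr_gt0//; lra.
have lam_lt1 : lam < 1 by rewrite ltr_pdivrMr; lra.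
have lamD : lam * D <= gap / 2.
  rewrite /lam mulrAC ler_pdivrMr; last lra.
  rewrite [leRHS](_ : _ = gap * (D + gap)); last by field.
  by rewrite ler_pM2l; lra.
pose eta := gap / (2 * N%:R).
have eta_gt0 : 0 < eta by rewrite divr_gt0// mulr_gt0.
have /choice[y yP] i : exists y, ~ S x y /\ nrm (y - xi i) <= d i + eta.
  have : (dist nrm (xi i) (~` S x) < (d i + eta)%:E)%E.
    by rewrite -[ltLHS]fineK// lte_fin ltrDl.
  by move=> /ereal_inf_lt[_ [y Cy <-]]; rewrite lte_fin => /ltW; exists y.
pose v i := (1 - lam) * w i + lam.
have v01 i : 0 <= v i <= 1.
  by have := w01 i; rewrite /v => /andP[wi0 wi1]; apply/andP; split; nra.
have v_sum : \sum_i v i = (1 - lam) * (eps * N%:R) + lam * N%:R.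
  by rewrite big_split -mulr_sumr /= w_sum sumr_const card_ord -[lam *+ N]mulr_natr.
have v_cost : \sum_i v i * nrm (y i - xi i) <= theta * N%:R.
  have le_i i : v i * nrm (y i - xi i) <= w i * d i + lam * d i + eta.
    have [_ yi] := yP i; have /andP[wi0 wi1] := w01 i; have /andP[vi0 vi1] := v01 i.
    have := d_ge0 i; rewrite /v in vi0 vi1 *.
    move=> di0; apply: (le_trans (ler_wpM2l vi0 yi)).
    have : 0 <= lam * (w i * d i) by rewrite mulr_ge0 ?(ltW lam_gt0) ?mulr_ge0.
    have := ler_wpM2r (ltW eta_gt0) vi1; lra.
  apply: (@le_trans _ _ (\sum_i (w i * d i + lam * d i + eta))).
    by apply: ler_sum => i _; exact: le_i.
  rewrite !big_split /= -mulr_sumr -/D sumr_const card_ord -[eta *+ N]mulr_natr.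
  have -> : eta * N%:R = gap / 2 by rewrite /eta; field; rewrite gt_eqF.
  by rewrite /gap in lamD *; lra.
have [P [PW PS]] := exists_partial_move nrmP N_gt0 xi y v01.
have PF : ambiguity_set nrm N_gt0 xi theta P.
  apply: le_trans PW _; rewrite lee_fin mulrC ler_pdivrMr//.
have := le_trans (chance_x P PF) (PS (S x) (fun i => (yP i).1)).
rewrite lee_fin lerD2l lerN2 leNgt mulrC ltr_pdivlMr// v_sum => /negP; apply.
have : 0 < lam * (1 - eps) * N%:R by rewrite mulr_gt0// mulr_gt0// subr_gt0.
lra.
Qed.

End feasibility.

Theorem theorem3 (R : realType) (K L N : nat)
    (nrm : 'rV[R]_K -> R) (nrmP : is_norm nrm)
    (N_gt0 : (0 < N)%N) (xi : 'I_N -> 'rV[R]_K)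
    (X : set 'rV[R]_L) (X_polyhedron : polyhedron X) (X_compact : compact X)
    (c : 'rV[R]_L)
    (S : 'rV[R]_L -> set 'rV[R]_K) (S_open : forall x, X x -> open (S x))
    (theta eps : R) (theta_gt0 : 0 < theta) (eps_gt0 : 0 < eps)
    (eps_lt1 : eps < 1) :
  let chance := drccp_feasible nrm N_gt0 xi X S theta eps in
  let determ := det_feasible nrm xi X S theta eps in
  let obj_chance := fun x : 'rV[R]_L => dotv c x in
  let obj_determ := fun z : 'rV[R]_N * R * 'rV[R]_L => dotv c z.2 in
  [/\ forall x, chance x <-> exists s t, determ (s, t, x),
      opt_value obj_chance chance = opt_value obj_determ determ
    & forall x, is_optimal obj_chance chance x <->
        exists s t, is_optimal obj_determ determ (s, t, x)].
Proof.
move=> chance determ obj_chance obj_determ.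
have equiv x : chance x <-> exists s t, determ (s, t, x).
  split; first exact: chance_determ.
  by move=> [s [t]]; exact: determ_chance.
split => //.
  congr ereal_inf; apply/seteqP; split => [_ [x /equiv[s [t st]] <-]|].
    by exists (s, t, x).
  by move=> _ [[[s t] x] st <-]; exists x => //; apply/equiv; exists s, t.
move=> x; split => [[/equiv[s [t st]] x_min]|[s [t [st st_min]]]].
  exists s, t; split => // -[[s' t'] x'] st'.
  by apply: x_min; apply/equiv; exists s', t'.
split; first by apply/equiv; exists s, t.
by move=> x' /equiv[s' [t' st']]; exact: (st_min (s', t', x')).
Qed.
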